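(* Let $0\le x<2$ be an algebraic number given by its minimal polynomial $P(t)\in\mathbb{Q}[t]$ and an isolating interval. Then the Rational Angle Recovery Algorithm checks whether $x$ is of the form $x=2\cos(p\pi/q)$ with a rational number $0<p/q\le 1/2$ and returns the pair $(p,q)$ with $q\ge 2$, $1\le p\le q-1$, $\gcd(p,q)=1$ in that case. If $x$ is not of this form, the algorithm returns $(0,0)$.
   Context: $\Phi$ denotes Euler's totient function. Chebyshev S-polynomials: $S_0(t)=0$, $S_1(t)=1$, $S_i(t)=t\,S_{i-1}(t)-S_{i-2}(t)$ for $i\ge 2$. Rational Angle Recovery Algorithm. Input: $x$ as in the claim, with minimal polynomial $P(t)$ and isolating interval (assumed sufficiently small, otherwise refined). (1) [Optional] Compute the number $\varrho$ of real roots of $P(t)$ in $[-2,2]$; if $\varrho\ne\deg P(t)$, return $(0,0)$. (2) Compute all numbers $q_1,\dots,q_k$ with $q_i\ge 2$ and $\Phi(2q_i)=2\deg P(t)$. (3) For $i=1,\dots,k$: if $P(t)$ divides $S_{q_i}(t)$, then compute an isolating interval of $q_i\arccos(x/2)/\pi$, let $p$ be the unique integer in this interval, and return $(p,q_i)$. (4) Return $(0,0)$. *)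

(* Defs.v *)
From mathcomp Require Import all_boot all_order all_algebra.
From mathcomp Require Import polyrcf.
From mathcomp Require Import all_classical all_reals all_analysis.

Set Implicit Arguments.
Unset Strict Implicit.
Unset Printing Implicit Defensive.

Import Order.TTheory GRing.Theory Num.Theory.

Local Open Scope ring_scope.

(* Chebyshev S-polynomials; with this indexing S_q has degree q - 1. *)
Fixpoint chebS (n : nat) : {poly rat} :=
  match n with
  | 0%N => 0
  | 1%N => 1
  | (n'.+1 as m).+1 => 'X * chebS m - chebS n'
  end.

Definition degp (P : {poly rat}) : nat := (size P).-1.

(* All numbers below are real, so polynomials and intervals with rational
   coefficients and endpoints are embedded into R by ratr. *)
Definition is_root (R : realType) (P : {poly rat}) (x : R) : bool :=
  root (map_poly ratr P) x.

Definition in_ratitv (R : realType) (I : interval rat) (x : R) : bool :=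
  x \in map_itv (ratr : rat -> R) I.

(* P is the monic generator of the ideal of rational polynomials that vanish
   at x; P is nonzero, so this entails that x is algebraic. *)
Definition minimal_polynomial (R : realType) (P : {poly rat}) (x : R) : Prop :=
  P \is monic /\ (forall Q : {poly rat}, is_root Q x = (P %| Q)).

Definition isolating (R : realType) (P : {poly rat}) (I : interval rat)
    (x : R) : Prop :=
  [/\ is_root P x, in_ratitv I x &
      forall y : R, is_root P y -> in_ratitv I y -> y = x].

(* The distinct real roots are counted. *)
Definition num_roots_m2_2 (R : realType) (P : {poly rat}) : nat :=
  count (fun t : R => -2 <= t <= 2) (rootsR (map_poly ratr P)).

Definition enumerates_candidates (P : {poly rat}) (qs : seq nat) : Prop :=
  uniq qs /\
  forall q : nat, (q \in qs) = (2 <= q)%N && (totient (2 * q) == 2 * degp P)%N.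

(* I' is a subinterval of I that still contains a root of P, hence still
   isolates the number isolated by I. *)
Definition refines (R : realType) (P : {poly rat}) (I' I : interval rat) :
    Prop :=
  (forall t : R, in_ratitv I' t -> in_ratitv I t) /\
  (exists x : R, isolating P I' x).

(* J encloses q * arccos (t / 2) / pi for every t in I'; in particular it
   contains the value at the number isolated by I'. *)
Definition angle_enclosure (R : realType) (q : nat) (I' J : interval rat) :
    Prop :=
  forall t : R, -2 <= t <= 2 -> in_ratitv I' t ->
    in_ratitv J (q%:R * acos (t / 2) / pi).

Definition unique_int_in (J : interval rat) (p : int) : Prop :=
  p%:~R \in J /\ (forall p' : int, p'%:~R \in J -> p' = p).

(* The algorithm is given by its big-step semantics, because the order of the
   candidates, the refinement of the input interval and the computed enclosures
   are left open.  Its data are only P and I: the number x is not an input. *)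
Inductive candidate_loop (R : realType) (P : {poly rat}) (I : interval rat) :
    seq nat -> int * nat -> Prop :=
| Loop_end : candidate_loop R P I [::] (0, 0%N)
| Loop_next (q : nat) (qs : seq nat) (out : int * nat) :
    ~~ (P %| chebS q) -> candidate_loop R P I qs out ->
    candidate_loop R P I (q :: qs) out
| Loop_return (q : nat) (qs : seq nat) (I' J : interval rat) (p : int) :
    P %| chebS q -> refines R P I' I -> angle_enclosure R q I' J ->
    unique_int_in J p ->
    candidate_loop R P I (q :: qs) (p, q).

Definition fails_root_test (R : realType) (P : {poly rat}) : bool :=
  num_roots_m2_2 R P != degp P.

(* opt tells whether the optional root test is performed. *)
Inductive rational_angle_recovery (R : realType) (opt : bool) (P : {poly rat})
    (I : interval rat) : int * nat -> Prop :=
| Recovery_reject :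
    opt && fails_root_test R P -> rational_angle_recovery R opt P I (0, 0%N)
| Recovery_search (qs : seq nat) (out : int * nat) :
    ~~ (opt && fails_root_test R P) -> enumerates_candidates P qs ->
    candidate_loop R P I qs out -> rational_angle_recovery R opt P I out.

Definition is_angle_of (R : realType) (x : R) (r : rat) : Prop :=
  0 < r <= 1 / 2 /\ x = 2 * cos (ratr r * pi).

(* Main.v *)
(* For coprime 0 < p < q, the number 2 cos (p pi / q) has degree Phi(2q)/2 over
   the rationals.  Write a conjugate of it as z + 1/z with z a primitive N-th
   root of unity, where N divides 2q; minimality of q among its divisors
   with P | S_q gives Phi(N) = Phi(2q).  As X^d P(X + 1/X) vanishes at z, the
   irreducibility of the N-th cyclotomic polynomial gives Phi(N) <= 2d, and
   rewriting the relation Phi_N(z) = 0 in terms of z + 1/z gives 2d <= Phi(N).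
   Since S_q is the product of the X - 2 cos (k pi / q) with 0 < k < q, a
   polynomial P dividing S_q has x = 2 cos (p' pi / q') for some q' dividing q,
   and the test Phi(2q) = 2d forces q' = q, because Phi(2 _) is strictly
   monotone for divisibility. *)
Require Import Defs.
From mathcomp Require Import all_boot all_order all_algebra all_field.
From mathcomp Require Import polyrcf zify ring lra.
From mathcomp Require Import all_classical all_reals all_analysis.

Import Order.TTheory GRing.Theory Num.Theory.
Import numFieldNormedType.Exports.

(** * Euler's totient at even arguments *)

Lemma totient_mul_prime (n p : nat) : (0 < n)%N -> prime p ->
  totient (p * n) = ((if (p %| n)%N then p else p.-1) * totient n)%N.
Proof.
move=> n_gt0 p_pr; have [m pNm ->] := pfactor_coprime p_pr n_gt0.
set k := logn p n; case: k => [|k].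
  rewrite expn0 muln1 totient_coprime // (totient_prime p_pr).
  by move: pNm; rewrite prime_coprime // => /negbTE ->.
rewrite dvdn_mull ?dvdn_exp //.
have mp e : coprime m (p ^ e) by rewrite coprime_sym coprimeXl.
rewrite mulnCA -expnS !(totient_coprime (mp _)) !totient_pfactor //= expnS; lia.
Qed.

(* On even arguments a prime factor multiplies the totient by at least 2:
   either p divides the argument already, or p is odd and contributes p - 1. *)
Lemma totient_double_mul_prime (n p : nat) : (0 < n)%N -> prime p ->
  exists c : nat, [/\ totient (2 * (p * n)) = (c * totient (2 * n))%N,
    (2 <= c)%N, (p <= c ^ 2)%N & ~~ odd c || (p %| n)%N].
Proof.
move=> n_gt0 p_pr; rewrite mulnCA totient_mul_prime //; last by lia.
have p_gt1 := prime_gt1 p_pr.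
have [->|p2] := eqVneq p 2%N.
  by rewrite dvdn_mulr //; exists 2%N.
have p_odd : odd p by case: (even_prime p_pr) p2 => // ->.
(* The bound [p <= (p - 1)^2] needs [p >= 3]. *)
have p_gt2 : (2 < p)%N by rewrite ltn_neqAle eq_sym p2.
rewrite Euclid_dvdM // (@gtnNdvd 2 p) //=.
case: ifP => pn.
  by exists p; split=> //; [nia | rewrite orbT].
exists p.-1; split => //; [lia| nia|].
by rewrite orbF; case: p p_odd {p_pr p_gt1 p2 p_gt2 pn} => //= p /negbTE ->.
Qed.

Lemma prime_mul_ind (Q : nat -> Prop) : Q 1%N ->
  (forall n p, (0 < n)%N -> prime p -> Q n -> Q (p * n)%N) ->
  forall n, (0 < n)%N -> Q n.
Proof.
move=> Q1 QM; elim/ltn_ind => n IHn n_gt0.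
have [n_le1|n_gt1] := leqP n 1; first by have -> : n = 1%N by lia.
have p_pr := pdiv_prime n_gt1; have p_gt1 := prime_gt1 p_pr.
rewrite -(divnK (pdiv_dvd n)) mulnC.
have d_gt0 : (0 < n %/ pdiv n)%N by rewrite divn_gt0 ?pdiv_leq ?pdiv_gt0.
by apply: QM => //; apply: IHn => //; rewrite ltn_Pdiv.
Qed.

(** Each prime factor [p] contributes a factor [c] with [p <= c ^ 2]. This bounds the candidates [q]
    in terms of the degree of [P], so that they form a finite list. *)
Lemma totient_double_lower_bound (n : nat) : (0 < n)%N ->
  (n <= totient (2 * n) ^ 2)%N.
Proof.
move: n; apply: prime_mul_ind => // n p n_gt0 p_pr IHn.
have [c [-> _ pc _]] := totient_double_mul_prime n p n_gt0 p_pr.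
by rewrite expnMn leq_mul.
Qed.

(** Every prime factor of [k] at least doubles the totient. *)
Lemma totient_double_lt (n k : nat) : (0 < n)%N -> (1 < k)%N ->
  (totient (2 * n) < totient (2 * (k * n)))%N.
Proof.
move=> n_gt0 k_gt1; suff: k = 1%N \/ (totient (2 * n) < totient (2 * (k * n)))%N.
  by case=> // k1; rewrite k1 in k_gt1.
have : (0 < k)%N by lia.
move: k {k_gt1}; apply: prime_mul_ind; first by left.
move=> k p k_gt0 p_pr IHk; right; rewrite -mulnA.
have [|c [-> c2 _ _]] := totient_double_mul_prime (k * n) p _ p_pr; first by lia.
have : (0 < totient (2 * n))%N by rewrite totient_gt0; lia.
by case: IHk => [->|]; rewrite ?mul1n; nia.
Qed.

(** The factor contributed by a prime [p] is even unless [p] divides the part [n] already treated;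
    then [n] is not 1, and the induction hypothesis supplies an even factor. *)
Lemma totient_double_even (n : nat) : (1 < n)%N -> ~~ odd (totient (2 * n)).
Proof.
move=> n_gt1; have : (0 < n)%N by lia.
suff: forall n, (0 < n)%N -> n = 1%N \/ ~~ odd (totient (2 * n)).
  by move=> /(_ n) H /H[n1|//]; rewrite n1 in n_gt1.
apply: prime_mul_ind => [|{n_gt1} {}n p n_gt0 p_pr IHn]; first by left.
right; have [c [-> _ _]] := totient_double_mul_prime n p n_gt0 p_pr.
rewrite oddM negb_and => /orP[-> //|pn].
case: IHn => [n1|->]; last by rewrite orbT.
by move: pn (prime_gt1 p_pr); rewrite n1 dvdn1 => /eqP ->.
Qed.

Local Open Scope ring_scope.

(** * Chebyshev S-polynomials *)

Lemma chebSS (n : nat) : chebS n.+2 = 'X * chebS n.+1 - chebS n.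
Proof. by []. Qed.

Lemma chebS_size_monic (n : nat) : size (chebS n) = n /\
  (0 < n -> chebS n \is monic)%N.
Proof.
suff: (size (chebS n) = n /\ (0 < n -> chebS n \is monic)%N) /\
  (size (chebS n.+1) = n.+1 /\ chebS n.+1 \is monic) by case.
elim: n => [|n [[sn _] [sn1 mn1]]].
  by rewrite /= size_poly0 size_poly1 monic1.
have c0 : chebS n.+1 != 0 by rewrite monic_neq0.
split=> //; rewrite chebSS.
have sX : size ('X * chebS n.+1) = n.+2 by rewrite mulrC size_mulX // sn1.
have lt : (size (- chebS n)%R < size ('X * chebS n.+1)%R)%N by rewrite size_polyN sn sX.
rewrite size_polyDl // sX; split=> //.
by rewrite monicE lead_coefDl // lead_coefM lead_coefX mul1r -monicE.
Qed.

Lemma size_chebS (n : nat) : size (chebS n) = n.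
Proof. by case: (chebS_size_monic n). Qed.

Lemma chebS_monic (n : nat) : (0 < n)%N -> chebS n \is monic.
Proof. by case: (chebS_size_monic n). Qed.

Lemma horner_chebSS (F : numFieldType) (n : nat) (t : F) :
  (map_poly ratr (chebS n.+2)).[t] =
  t * (map_poly ratr (chebS n.+1)).[t] - (map_poly ratr (chebS n)).[t].
Proof. by rewrite chebSS rmorphB rmorphM /= map_polyX !hornerE. Qed.

(** For [y = e^(it)] this is [sin t * S_n(2 cos t) = sin (n t)]. It degenerates to [0 = 0] at
    [y = 1] and [y = -1], so the values at [2] and [-2] are computed separately. *)
Lemma chebS_add_inv (F : numFieldType) (n : nat) (y : F) : y != 0 ->
  (y - y^-1) * (map_poly ratr (chebS n)).[y + y^-1] = y ^+ n - y^-1 ^+ n.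
Proof.
move=> y0; suff: (y - y^-1) * (map_poly ratr (chebS n)).[y + y^-1] = y ^+ n - y^-1 ^+ n /\
  (y - y^-1) * (map_poly ratr (chebS n.+1)).[y + y^-1] = y ^+ n.+1 - y^-1 ^+ n.+1 by case.
elim: n => [|n [IH0 IH1]].
  by rewrite /= rmorph0 rmorph1 !hornerE subrr.
split=> //; rewrite horner_chebSS mulrBr mulrCA IH0 IH1 !exprS.
have yV : y * y^-1 = 1 by rewrite mulfV.
have Vy : y^-1 * y = 1 by rewrite mulVf.
rewrite mulrDl !mulrBr !mulrA yV Vy !mul1r; ring.
Qed.

Lemma horner_chebS_at_2 (F : numFieldType) (n : nat) :
  (map_poly ratr (chebS n)).[2 : F] = n%:R.
Proof.
suff: (map_poly ratr (chebS n)).[2 : F] = n%:R /\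
  (map_poly ratr (chebS n.+1)).[2 : F] = n.+1%:R by case.
elim: n => [|n [IH0 IH1]]; first by rewrite /= rmorph0 rmorph1 !hornerE.
by split=> //; rewrite horner_chebSS IH0 IH1 -!natr1; ring.
Qed.

Lemma horner_chebS_at_N2 (F : numFieldType) (n : nat) :
  (map_poly ratr (chebS n)).[- 2 : F] = - (-1) ^+ n * n%:R.
Proof.
suff: (map_poly ratr (chebS n)).[- 2 : F] = - (-1) ^+ n * n%:R /\
  (map_poly ratr (chebS n.+1)).[- 2 : F] = - (-1) ^+ n.+1 * n.+1%:R by case.
elim: n => [|n [IH0 IH1]]; first by rewrite /= rmorph0 rmorph1 !hornerE /= expr1; split; ring.
by split=> //; rewrite horner_chebSS IH0 IH1 !exprS -!natr1; ring.
Qed.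

(** * Degree of [z + 1/z] for a root of unity [z] *)

Lemma irreducible_dvdp_common_root (F : numFieldType) (P Q : {poly rat}) (w : F) :
  irreducible_poly P -> root (map_poly ratr P) w -> root (map_poly ratr Q) w ->
  P %| Q.
Proof.
move=> [_ irrP] Pw Qw; have gw : root (map_poly ratr (gcdp P Q)) w.
  by rewrite gcdp_map root_gcd Pw.
have g1 : size (gcdp P Q) != 1%N.
  apply/negP => /size_poly1P[c c0 gc]; move: gw.
  by rewrite gc map_polyC /= rootC fmorph_eq0 (negPf c0).
by rewrite -(eqp_dvdl _ (irrP _ g1 (dvdp_gcdl P Q))) dvdp_gcdr.
Qed.

Lemma prim_root_inv (F : fieldType) (N : nat) (z : F) :
  N.-primitive_root z -> N.-primitive_root z^-1.
Proof.
move=> zN; have N_gt0 := prim_order_gt0 zN.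
have -> : z^-1 = z ^+ N.-1.
  apply: (@mulfI _ z); first by rewrite (prim_root_eq0 zN) -lt0n.
  by rewrite -exprS prednK // (prim_expr_order zN) mulfV // (prim_root_eq0 zN) -lt0n.
by rewrite (prim_root_exp_coprime _ zN) coprimePn.
Qed.

Lemma totient_le_double_degree (P : {poly rat}) (N : nat) (z : algC) :
  P != 0 -> N.-primitive_root z -> root (map_poly ratr P) (z + z^-1) ->
  (totient N <= 2 * degp P)%N.
Proof.
move=> P0 zN; set d := degp P => Pw.
have z0 : z != 0 by rewrite (prim_root_eq0 zN) -lt0n (prim_order_gt0 zN).
(* [T = X^d P(X + 1/X)] *)
pose T : {poly rat} := \sum_(i < d.+1) P`_i *: (('X^2 + 1) ^+ i * 'X^(d - i)).
have sP : size P = d.+1 by rewrite /d /degp prednK // lt0n size_poly_eq0.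
(* At 0 only the summand [i = d] survives, so the constant term of [T] is the leading coefficient of
   [P]. *)
have T0 : T != 0.
  have : T.[0] = lead_coef P.
    rewrite /T horner_sum big_ord_recr /= big1 => [|i _].
      rewrite add0r subnn expr0 mulr1 hornerZ horner_exp hornerD hornerXn hornerC.
      by rewrite expr0n add0r expr1n mulr1 lead_coefE sP.
    by rewrite hornerZ hornerM hornerXn expr0n subn_eq0 leqNgt ltn_ord !mulr0.
  by apply: contra_eq_neq => ->; rewrite horner0 eq_sym lead_coef_eq0.
have sT : (size T <= (2 * d).+1)%N.
  apply: (leq_trans (size_sum _ _ _)); apply/bigmax_leqP => i _.
  apply: (leq_trans (size_scale_leq _ _)); apply: (leq_trans (size_polyMleq _ _)).
  have := size_poly_exp_leq ('X^2 + 1 : {poly rat}) i.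
  rewrite size_XnaddC //= size_polyXn; have := ltn_ord i; lia.
have Tz : root (map_poly ratr T) z.
  apply/rootP; rewrite rmorph_sum horner_sum /=.
  transitivity (z ^+ d * (map_poly ratr P).[z + z^-1]); last first.
    by rewrite (rootP Pw) mulr0.
  rewrite horner_coef size_map_poly sP mulr_sumr.
  apply: eq_bigr => i _; rewrite coef_map map_polyZ hornerZ.
  rewrite -[X in X * _]/(ratr P`_i) -[X in _ = _ * (X * _)]/(ratr P`_i).
  have -> : map_poly ratr (('X^2 + 1) ^+ i * 'X^(d - i)) =
      ('X^2 + 1) ^+ i * 'X^(d - i) :> {poly algC}.
    by rewrite rmorphM rmorphXn rmorphD rmorph1 /= !map_polyXn.
  move: (ratr P`_i) => c.
  rewrite hornerM !horner_exp hornerD horner_exp hornerX hornerC.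
  have -> : z ^+ d = z ^+ i * z ^+ (d - i) by rewrite -exprD subnKC // -ltnS ltn_ord.
  have -> : z ^+ 2 + 1 = z * (z + z^-1) by rewrite mulrDr mulfV // expr2.
  by rewrite exprMn; ring.
(* Irreducibility of the cyclotomic polynomial enters here: the minimal polynomial of [z] over the
   rationals has degree [totient N]. *)
have [p [pz pm] pdiv] := minCpolyP z.
have sp : size p = (totient N).+1.
  rewrite -(size_map_poly (ratr : {rmorphism rat -> algC})) -pz.
  by rewrite (minCpoly_cyclotomic zN) size_cyclotomic.
have : p %| T by rewrite -pdiv.
by move/(dvdp_leq T0); rewrite sp => /leq_trans/(_ sT).
Qed.

(** These are [2 T_n(X / 2)] for the Chebyshev polynomials [T_n] of the first kind; they send
    [y + 1/y] to [y^n + y^-n]. *)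
Fixpoint chebC (n : nat) : {poly rat} :=
  match n with
  | 0%N => 2%:P
  | 1%N => 'X
  | (n'.+1 as m).+1 => 'X * chebC m - chebC n'
  end.

Lemma size_chebC (n : nat) : (size (chebC n) <= n.+1)%N.
Proof.
suff: (size (chebC n) <= n.+1)%N /\ (size (chebC n.+1) <= n.+2)%N by case.
elim: n => [|n [IH0 IH1]]; first by rewrite /= size_polyX size_polyC.
split=> //; rewrite -[chebC n.+2]/('X * chebC n.+1 - chebC n).
apply: (leq_trans (size_polyD _ _)); rewrite size_polyN geq_max.
apply/andP; split; last by apply: leq_trans IH0 _; lia.
by apply: (leq_trans (size_polyMleq _ _)); rewrite size_polyX; lia.
Qed.

Lemma chebC_add_inv (F : numFieldType) (n : nat) (y : F) : y != 0 ->
  (map_poly ratr (chebC n)).[y + y^-1] = y ^+ n + y^-1 ^+ n.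
Proof.
move=> y0; suff: (map_poly ratr (chebC n)).[y + y^-1] = y ^+ n + y^-1 ^+ n /\
  (map_poly ratr (chebC n.+1)).[y + y^-1] = y ^+ n.+1 + y^-1 ^+ n.+1 by case.
elim: n => [|n [IH0 IH1]].
  by rewrite /= map_polyC map_polyX /= !hornerE ratr_nat !expr0 !expr1.
split=> //; rewrite -[chebC n.+2]/('X * chebC n.+1 - chebC n).
rewrite rmorphB rmorphM /= map_polyX !hornerE IH0 IH1 !exprS.
have yV : y * y^-1 = 1 by rewrite mulfV.
have Vy : y^-1 * y = 1 by rewrite mulVf.
rewrite mulrDl !mulrDr !mulrA yV Vy !mul1r; ring.
Qed.

(* [C_|j-m| (y + 1/y) = y^(j-m) + y^(m-j)], with the negative powers cleared. *)
Lemma chebC_dist_add_inv (F : numFieldType) (j m : nat) (y : F) : y != 0 ->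
  y ^+ m * (map_poly ratr (chebC (maxn j m - minn j m))).[y + y^-1] =
  y ^+ j + y ^+ (2 * m) * y^-1 ^+ j.
Proof.
move=> y0; rewrite chebC_add_inv //.
have [jm|mj] := leqP j m.
  rewrite (_ : m = j + (m - j))%N; last by lia.
  rewrite {1}addnC; move: (m - j)%N => k; rewrite addKn.
  rewrite mul2n -addnn !exprD !exprVn; field.
  by rewrite !expf_neq0.
rewrite (_ : j = m + (j - m))%N; last by lia.
move: (j - m)%N => k; rewrite addKn.
rewrite mul2n -addnn !exprD !exprVn; field.
by rewrite !expf_neq0.
Qed.

(* Adding [z^-m Phi_N z = 0] and [z^m Phi_N (1/z) = 0], where [2 m] is the
   degree of [Phi_N], gives a polynomial relation of degree at most [m] for
   [z + 1/z]; it is not trivial, as for [z = 1] it would read [2 Phi_N 1 = 0]. *)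
Lemma double_degree_le_totient (P : {poly rat}) (N : nat) (z : algC) :
  irreducible_poly P -> (1 < N)%N -> ~~ odd (totient N) ->
  N.-primitive_root z -> root (map_poly ratr P) (z + z^-1) ->
  (2 * degp P <= totient N)%N.
Proof.
move=> irrP N1 evN zN Pw; set m := (totient N)./2.
have Nm : totient N = (2 * m)%N by rewrite mul2n even_halfK.
pose F : {poly rat} := \sum_(j < (2 * m).+1)
  (('Phi_N)`_j)%:~R *: chebC (maxn j m - minn j m).
have FE (y : algC) : y != 0 -> y ^+ m * (map_poly ratr F).[y + y^-1] =
    (cyclotomic z N).[y] + y ^+ (2 * m) * (cyclotomic z N).[y^-1].
  move=> y0; rewrite !(horner_coef (cyclotomic z N)) size_cyclotomic Nm.
  rewrite -(Cintr_Cyclotomic zN).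
  rewrite mulr_sumr -big_split rmorph_sum horner_sum mulr_sumr /=.
  apply: eq_bigr => j _; rewrite map_polyZ hornerZ /= mulrCA chebC_dist_add_inv //.
  rewrite coef_map /= ratr_int; ring.
have z0 : z != 0 by rewrite (prim_root_eq0 zN) -lt0n (prim_order_gt0 zN).
have Fw : root (map_poly ratr F) (z + z^-1).
  have : z ^+ m * (map_poly ratr F).[z + z^-1] = 0.
    rewrite FE // (rootP (_ : root _ z)) ?root_cyclotomic //.
    rewrite (rootP (_ : root _ z^-1)) ?root_cyclotomic ?mulr0 ?addr0 //.
    exact: prim_root_inv.
  by move/eqP; rewrite mulf_eq0 expf_eq0 (negPf z0) andbF.
have F0 : F != 0.
  apply/eqP => F0; have := FE 1 (oner_neq0 _).
  rewrite F0 rmorph0 horner0 mulr0 invr1 expr1n mul1r -mulr2n => /esym/eqP.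
  rewrite mulrn_eq0 /= -[_ == 0]/(root _ _) root_cyclotomic //.
  by move/prim_order_dvd/(_ 1%N); rewrite expr1 eqxx dvdn1 => /eqP N_eq1;
    rewrite N_eq1 in N1.
(* For [j <= 2 m] the index [|j - m|] is at most [m]; this is where the degree is halved. *)
have sF : (size F <= m.+1)%N.
  apply: (leq_trans (size_sum _ _ _)); apply/bigmax_leqP => i _.
  apply: (leq_trans (size_scale_leq _ _)); apply: (leq_trans (size_chebC _)).
  by have := ltn_ord i; lia.
have := dvdp_leq F0 (irreducible_dvdp_common_root _ _ _ _ irrP Pw Fw).
by move/leq_trans/(_ sF); rewrite Nm leq_mul2l /degp; case: (size P).
Qed.

Lemma irreducible_dvdp_chebS_degree (P : {poly rat}) (b : nat) :
  irreducible_poly P -> (1 < b)%N -> P %| chebS b ->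
  (forall b', (b' %| b)%N -> P %| chebS b' -> b' = b) ->
  (2 * degp P = totient (2 * b))%N.
Proof.
move=> irrP b1 Pb bmin; have P0 : P != 0 by rewrite -size_poly_gt0; case: irrP => /ltnW.
have : size (map_poly (ratr : rat -> algC) P) != 1%N.
  by rewrite size_map_poly; case: irrP => [/gtn_eqF->].
move=> /closed_rootP[w Pw].
(* [z] is a root of [X^2 - w X + 1], and the constant term 1 makes it nonzero. *)
have [z [z0 wE]] : exists z : algC, z != 0 /\ w = z + z^-1.
  have : size ('X^2 - (w *: 'X - 1) : {poly algC}) != 1%N.
    have sZ : (size (- (w *: 'X - 1) : {poly algC})%R < 3)%N.
      rewrite size_polyN; apply: leq_ltn_trans (size_polyD _ _) _.
      rewrite size_polyN size_poly1 gtn_max andbT ltnS.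
      by apply: leq_trans (size_scale_leq _ _) _; rewrite size_polyX.
    by rewrite size_polyDl size_polyXn.
  move=> /closed_rootP[z /rootP]; rewrite !hornerE => zE.
  have z0 : z != 0 by apply: contra_eq_neq zE => ->;
    rewrite expr0n !mulr0 !add0r opprK oner_eq0.
  exists z; split=> //; apply: (mulIf z0); rewrite mulrDl mulVf //.
  by apply/eqP; rewrite -subr_eq0 -oppr_eq0 -zE; apply/eqP; ring.
have Sroot n : P %| chebS n -> root (map_poly ratr (chebS n)) w.
  by move: Pw; rewrite -!dvdp_XsubCl => /dvdp_trans Pw Pn; rewrite Pw ?dvdp_map.
(* If [z = 1/z], then [w] is [2] or [-2], where [S_b] takes the nonzero value [b] up to sign. *)
have zz : z - z^-1 != 0.
  apply/negP => /eqP zV; have : z ^+ 2 = 1.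
    by rewrite expr2 -{2}(subrK z^-1 z) zV add0r mulfV.
  have := rootP (Sroot b Pb); rewrite wE => Sb /eqP; rewrite sqrf_eq1.
  have bR : b%:R != 0 :> algC by rewrite pnatr_eq0; lia.
  case/orP => /eqP zE; move: Sb; rewrite zE ?invrN ?invr1.
    by rewrite -[1 + 1]/(2 : algC) horner_chebS_at_2 => /eqP; rewrite (negPf bR).
  rewrite -opprD -[1 + 1]/(2 : algC) horner_chebS_at_N2 => /eqP.
  by rewrite mulf_eq0 oppr_eq0 signr_eq0 (negPf bR).
(* As [z - 1/z] is nonzero, [S_n] vanishes at [w] exactly when [z^n = z^-n]. *)
have Sz n : root (map_poly ratr (chebS n)) w = (z ^+ (2 * n) == 1).
  rewrite /root wE -(inj_eq (mulfI zz)) mulr0 chebS_add_inv //.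
  rewrite mul2n -addnn exprD subr_eq0 exprVn -(inj_eq (mulIf (expf_neq0 n z0))).
  by rewrite mulVf // expf_neq0.
have z2b : z ^+ (2 * b) = 1 by apply/eqP; rewrite -Sz; exact: Sroot.
have [|N zN Nb] := prim_order_exists _ z2b; first by lia.
(* If [N] divides [2 b'], then [w] is a root of [S_b'], which the irreducible [P] therefore
   divides. *)
have smin b' : (b' %| b)%N -> (N %| 2 * b')%N -> b' = b.
  move=> bb Nb'; apply: bmin => //.
  apply: irreducible_dvdp_common_root irrP Pw _.
  by rewrite Sz -(prim_order_dvd zN).
have N0 := prim_order_gt0 zN.
(* Minimality gives [b = N] for odd [N], where [totient (2 * N) = totient N], and [b = N / 2] for
   even [N]. *)
have NE : totient N = totient (2 * b).
  have [oN|eN] := boolP (odd N).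
    have Nb' : (N %| b)%N by rewrite Gauss_dvdr // coprimen2 in Nb.
    have bN := smin N Nb' (dvdn_mull _ (dvdnn _)).
    by rewrite -bN totient_coprime ?coprime2n // mul1n.
  have N2 : N = (2 * N./2)%N by rewrite mul2n even_halfK.
  rewrite N2; congr (totient (2 * _)); apply: smin; last by rewrite -N2.
  by move: Nb; rewrite {1}N2 dvdn_pmul2l.
have N1 : (1 < N)%N.
  have : (1 < totient N)%N by rewrite NE totient_gt1; lia.
  by case: N N0 {zN Nb smin NE} => [|[|]].
rewrite wE in Pw; apply/eqP; rewrite eqn_leq -NE.
rewrite (totient_le_double_degree _ _ _ P0 zN Pw) andbT.
by apply: double_degree_le_totient irrP N1 _ zN Pw; rewrite NE totient_double_even.
Qed.

(** * Real roots of the S-polynomials *)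

Lemma sin_horner_chebS (R : realType) (n : nat) (t : R) :
  sin t * (map_poly ratr (chebS n)).[2 * cos t] = sin (n%:R * t).
Proof.
suff: sin t * (map_poly ratr (chebS n)).[2 * cos t] = sin (n%:R * t) /\
  sin t * (map_poly ratr (chebS n.+1)).[2 * cos t] = sin (n.+1%:R * t) by case.
elim: n => [|n [IH0 IH1]].
  by rewrite /= rmorph0 rmorph1 !hornerE sin0.
split=> //; rewrite horner_chebSS mulrBr mulrCA IH0 IH1.
have -> : n.+2%:R * t = n.+1%:R * t + t by rewrite -[n.+2%:R]natr1; ring.
have -> : n%:R * t = n.+1%:R * t - t by rewrite -[n.+1%:R]natr1; ring.
by rewrite sinB sinD; ring.
Qed.

Lemma cos_mul_pi_inj (R : realType) (r s : R) : 0 <= r <= 1 -> 0 <= s <= 1 ->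
  cos (r * pi) = cos (s * pi) -> r = s.
Proof.
have pi0 := pi_gt0 R; move=> /andP[r0 r1] /andP[s0 s1] /cos_inj rs.
by apply: (mulIf (lt0r_neq0 pi0)); apply: rs; rewrite in_itv /=; apply/andP; split; nra.
Qed.

Lemma natr_div_itv (F : numFieldType) (k q : nat) :
  (0 < k < q)%N -> 0 < (k%:R / q%:R : F) < 1.
Proof.
move=> /andP[k0 kq]; have q0 : (0 < q)%N by apply: leq_trans kq.
by rewrite divr_gt0 ?ltr0n //= ltr_pdivrMr ?ltr0n // mul1r ltr_nat.
Qed.

Definition chebS_roots (R : realType) (q : nat) : seq R :=
  [seq 2 * cos (k%:R / q%:R * pi) | k <- iota 1 q.-1].

Lemma mem_chebS_roots (R : realType) (q : nat) (x : R) : (0 < q)%N ->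
  reflect (exists2 k : nat, (0 < k < q)%N & x = 2 * cos (k%:R / q%:R * pi))
    (x \in chebS_roots R q).
Proof.
move=> q0; apply: (iffP mapP) => -[k kq xE]; exists k => //; move: kq.
  by rewrite mem_iota add1n prednK.
by rewrite mem_iota add1n prednK.
Qed.

Lemma chebS_roots_uniq (R : realType) (q : nat) : (0 < q)%N -> uniq (chebS_roots R q).
Proof.
move=> q0; have qR : q%:R != 0 :> R by rewrite pnatr_eq0 -lt0n.
have kq k : k \in iota 1 q.-1 -> (0 < k < q)%N.
  by rewrite mem_iota add1n prednK.
rewrite map_inj_in_uniq ?iota_uniq // => k l /kq kk /kq ll.
have k2 : (2 : R) != 0 by rewrite pnatr_eq0.
move/(mulfI k2)/cos_mul_pi_inj; case/andP: (natr_div_itv R _ _ kk) => ? ?.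
case/andP: (natr_div_itv R _ _ ll) => ? ?; rewrite !ltW // => /(_ isT isT).
by move=> /(divIf qR)/eqP; rewrite eqr_nat => /eqP.
Qed.

(** The [q - 1] listed numbers are distinct roots, and [S_q] is monic of degree [q - 1], so there
    are no others. *)
Lemma chebS_factor (R : realType) (q : nat) : (0 < q)%N ->
  map_poly ratr (chebS q) = \prod_(z <- chebS_roots R q) ('X - z%:P).
Proof.
move=> q0; have qR : q%:R != 0 :> R by rewrite pnatr_eq0 -lt0n.
rewrite [LHS](@all_roots_prod_XsubC _ _ (chebS_roots R q)).
- by rewrite lead_coef_map (monicP (chebS_monic _ q0)) rmorph1 scale1r.
- by rewrite size_map_poly size_chebS size_map size_iota prednK.
- apply/allP => z /mem_chebS_roots-/(_ q0)[k /(natr_div_itv R)/andP[k0 k1] ->].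
  (* The angle lies strictly between 0 and [pi], so its sine is positive and can be cancelled. *)
  have pi0 := pi_gt0 R; have : 0 < sin (k%:R / q%:R * pi : R) by apply: sin_gt0_pi; nra.
  move=> /lt0r_neq0 s0; apply/rootP/(mulfI s0).
  rewrite mulr0 sin_horner_chebS.
  have -> : q%:R * (k%:R / q%:R * pi) = pi *+ k :> R by rewrite -mulr_natl; field.
  by rewrite -[_ *+ k]add0r (alternatingn (@sinDpi R)) sin0 mulr0.
- by rewrite uniq_rootsE chebS_roots_uniq.
Qed.

Lemma is_root_chebS (R : realType) (q : nat) (x : R) : (0 < q)%N ->
  is_root (chebS q) x <->
  exists2 k : nat, (0 < k < q)%N & x = 2 * cos (k%:R / q%:R * pi).
Proof.
move=> q0; rewrite /is_root chebS_factor // root_prod_XsubC.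
by split=> [/mem_chebS_roots-/(_ q0)|/mem_chebS_roots-/(_ q0)].
Qed.

(** * Minimal polynomials of cosines of rational angles *)

Lemma minimal_polynomial_irreducible (R : realType) (P : {poly rat}) (x : R) :
  minimal_polynomial P x -> irreducible_poly P.
Proof.
move=> [/monic_neq0 P0 Pdvd]; have P1 : (1 < size P)%N.
  rewrite ltn_neqAle size_poly_gt0 P0 andbT eq_sym; apply/negP => P1.
  have : P %| 1 by rewrite dvdp1.
  by rewrite -Pdvd /is_root rmorph1 (negPf (root1 _)).
split=> // Q Q1 /[dup] QP /dvdpP[S PE]; have : is_root P x by rewrite Pdvd.
(* If [P] divides the cofactor [S], the degrees contradict [size Q != 1]; otherwise [P] divides [Q]
   and the two are associated. *)
rewrite {1}PE /is_root rmorphM rootM => /orP[]; rewrite -/(is_root _ x) Pdvd => Pd.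
  have [S0 Q0] : S != 0 /\ Q != 0.
    by apply/andP; rewrite -negb_or -mulf_eq0 -PE.
  have := dvdp_leq S0 Pd; rewrite PE size_mul //.
  by move: Q1; rewrite -size_poly_gt0 in Q0; move: Q0; case: (size Q) => [|[|m]] // _ _; lia.
by rewrite /eqp QP.
Qed.

Lemma ratr_natr_div (F : numFieldType) (p q : nat) :
  ratr (p%:R / q%:R) = p%:R / q%:R :> F.
Proof. by rewrite fmorph_div /= !ratr_nat. Qed.

Lemma is_angle_of_natr_div (R : realType) (x : R) (r : rat) : is_angle_of x r ->
  exists p q : nat, [/\ r = p%:R / q%:R, (0 < p < q)%N, coprime p q &
    x = 2 * cos (p%:R / q%:R * pi)].
Proof.
move=> [/andP[r0 r1] xE]; exists `|numq r|%N, `|denq r|%N.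
have rE : r = `|numq r|%N%:R / `|denq r|%N%:R.
  rewrite -[LHS]divq_num_den !pmulrn !gez0_abs ?denq_ge0 //.
  by rewrite numq_ge0 ltW.
have n0 : (0 < `|numq r|)%N by rewrite absz_gt0 numq_eq0 gt_eqF.
have d0 : (0 < `|denq r|)%N by rewrite absz_gt0 denq_eq0.
split => //; first last.
- by rewrite -ratr_natr_div -rE.
- by rewrite coprime_num_den.
rewrite n0 -(ltr_nat rat) -[ltRHS]mul1r -ltr_pdivrMr ?ltr0n // -rE.
lra.
Qed.

(** A reduced fraction [p / q] can have denominator [b] only if [q] divides [b]. Hence no proper
    divisor [b] of [q] has [P] dividing [S_b], which is the minimality that the degree formula asks
    for. *)
Lemma cos_angle_degree (R : realType) (x : R) (P : {poly rat}) (p q : nat) :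
  minimal_polynomial P x -> (0 < p < q)%N -> coprime p q ->
  x = 2 * cos (p%:R / q%:R * pi) ->
  P %| chebS q /\ (2 * degp P = totient (2 * q))%N.
Proof.
move=> hP pq copq xE; have q1 : (1 < q)%N by lia.
have q0 : (0 < q)%N by lia.
have PS : P %| chebS q.
  by rewrite -hP.2; apply/is_root_chebS => //; exists p.
split=> //; apply: irreducible_dvdp_chebS_degree => //.
  exact: minimal_polynomial_irreducible hP.
move=> b bq; have b0 : (0 < b)%N by apply: dvdn_gt0 bq.
rewrite -hP.2 => /is_root_chebS[//|k kb]; rewrite xE.
have k2 : (2 : R) != 0 by rewrite pnatr_eq0.
move/(mulfI k2)/cos_mul_pi_inj.
case/andP: (natr_div_itv R _ _ pq) => ? ?.
case/andP: (natr_div_itv R _ _ kb) => ? ?; rewrite !ltW // => /(_ isT isT).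
move/eqP; rewrite eqr_div ?pnatr_eq0 -?lt0n // -!natrM eqr_nat => /eqP pk.
apply/eqP; rewrite eqn_dvd bq /= -(@Gauss_dvdr _ p) 1?coprime_sym //.
by rewrite pk dvdn_mull.
Qed.

(** Divisibility alone leaves [k / q] possibly not reduced. The reduced denominator [q'] obeys the
    degree formula too, so [q'] and [q] have the same [totient (2 * _)], and strict monotonicity
    excludes a proper divisor. *)
Lemma candidate_cos_angle (R : realType) (x : R) (P : {poly rat}) (q : nat) :
  minimal_polynomial P x -> (0 < q)%N -> P %| chebS q ->
  totient (2 * q) = (2 * degp P)%N ->
  exists p : nat, [/\ (0 < p < q)%N, coprime p q &
    x = 2 * cos (p%:R / q%:R * pi)].
Proof.
move=> hP q0; rewrite -hP.2 => /is_root_chebS[//|k kq xE] qP.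
have k0 : (0 < k)%N by lia.
have g0 : (0 < gcdn k q)%N by rewrite gcdn_gt0 q0 orbT.
have [k' kE] := dvdnP (dvdn_gcdl k q); have [q' qE] := dvdnP (dvdn_gcdr k q).
have k'0 : (0 < k')%N by lia.
have g1R : (gcdn k q)%:R != 0 :> R by rewrite pnatr_eq0 -lt0n.
have cop : coprime k' q'.
  by rewrite /coprime -(eqn_pmul2r g0) mul1n muln_gcdl -kE -qE.
have kq' : (0 < k' < q')%N.
  by rewrite k'0 -(ltn_pmul2r g0) -kE -qE; lia.
have xE' : x = 2 * cos (k'%:R / q'%:R * pi).
  rewrite xE; congr (2 * cos (_ * pi)); apply/eqP.
  rewrite eqr_div ?pnatr_eq0 -?lt0n //; last by lia.
  by rewrite -!natrM eqr_nat; move: (gcdn k q) kE qE => g -> ->; apply/eqP; ring.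
have [_] := cos_angle_degree _ _ _ _ _ hP kq' cop xE'; rewrite -qP.
have [g_gt1|g_le1] := ltnP 1 (gcdn k q).
  have qE' : q = (gcdn k q * q')%N by rewrite mulnC.
  by have := totient_double_lt q' (gcdn k q) _ g_gt1; rewrite -qE'; lia.
have g1 : gcdn k q = 1%N by lia.
by move=> _; exists k; split=> //; apply/eqP.
Qed.

(** * Rational intervals and enclosures of the angle *)

Lemma in_ratitvI (R : realType) (I J : interval rat) (t : R) :
  in_ratitv (Order.meet I J) t = in_ratitv I t && in_ratitv J t.
Proof.
have mono (a b : itv_bound rat) :
    (map_itv_bound (ratr : rat -> R) a <= map_itv_bound ratr b)%O = (a <= b)%O.
  by case: a b => [[] a|[]] [[] b|[]] //=; rewrite !bnd_simp ?ler_rat ?ltr_rat.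
have mapI (a b : itv_bound rat) : map_itv_bound (ratr : rat -> R) (Order.meet a b) =
    Order.meet (map_itv_bound ratr a) (map_itv_bound ratr b).
  by case: (leP a b) => [ab|/ltW ab]; apply/esym; [apply/meet_l|apply/meet_r]; rewrite mono.
have mapU (a b : itv_bound rat) : map_itv_bound (ratr : rat -> R) (Order.join a b) =
    Order.join (map_itv_bound ratr a) (map_itv_bound ratr b).
  by case: (leP a b) => [ab|/ltW ab]; apply/esym; [apply/join_r|apply/join_l]; rewrite mono.
rewrite /in_ratitv -in_itvI; case: I J => [a b] [c d] /=.
by rewrite mapI mapU.
Qed.

(** By continuity the angle function stays within 1/2 of its integer value [p] near [x], and the
    open interval of radius 1/2 about [p] contains no other integer. *)
Lemma exists_angle_enclosure (R : realType) (x : R) (P : {poly rat})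
    (I : interval rat) (q : nat) (p : int) : 0 <= x < 2 -> isolating P I x ->
  q%:R * acos (x / 2) / pi = p%:~R ->
  exists I' J : interval rat,
    [/\ refines R P I' I, angle_enclosure R q I' J & unique_int_in J p].
Proof.
move=> /andP[x0 x2] [Px Ix Iuniq] xp.
have cf : ((fun t : R => q%:R * acos (t / 2) / pi) @ x -->
  (q%:R * acos (x / 2) / pi : R))%classic.
  apply: cvgM; last exact: cvg_cst.
  apply: cvgM; first exact: cvg_cst.
  have cx : {for x / 2, continuous (@acos R)} by apply: continuous_acos; lra.
  apply: (cvg_comp (fun t => t / 2) acos _ cx).
  by apply: cvgM; [exact: cvg_id|exact: cvg_cst].
have h0 : 0 < 2^-1 :> R by rewrite invr_gt0.
move/cvgrPdist_lt/(_ _ h0)/nbhs_ballP: cf => [e /= e0 ball_e].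
have [a /[!in_itv]/=/andP[ea ax]] : exists a : rat, ratr a \in `]x - e, x[.
  by apply: rat_in_itvoo; lra.
have [b /[!in_itv]/=/andP[xb eb]] : exists b : rat, ratr b \in `]x, x + e[.
  by apply: rat_in_itvoo; lra.
(* Intersecting with [I] yields a refinement that still contains [x]. *)
exists (Order.meet I `]a, b[), `]p%:~R - 2^-1, p%:~R + 2^-1[; split.
- split=> [t|]; first by rewrite in_ratitvI => /andP[].
  exists x; split=> //; first by rewrite in_ratitvI Ix /in_ratitv /= in_itv /= ax xb.
  by move=> y Py; rewrite in_ratitvI => /andP[Iy _]; apply: Iuniq.
- move=> t _; rewrite in_ratitvI => /andP[_]; rewrite /in_ratitv /= in_itv /=.
  move=> /andP[a_t tb].
  have /ball_e /= : ball x e t by rewrite /ball /= ltr_norml; apply/andP; split; lra.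
  rewrite xp ltr_norml => /andP[h1 h2].
  rewrite in_itv /= rmorphB rmorphD /= fmorphV /= !ratr_int ratr_nat.
  by apply/andP; split; lra.
split; first by rewrite in_itv /=; apply/andP; split; lra.
move=> p'; rewrite in_itv /= => /andP[h1 h2].
have : (p < p' + 1)%R /\ (p' < p + 1)%R.
  by rewrite -!(ltr_int rat) !rmorphD /=; split; lra.
lia.
Qed.

(** * The root test, the candidates and the runs of the algorithm *)

Lemma num_roots_dvdp_chebS (R : realType) (P : {poly rat}) (q : nat) :
  (0 < q)%N -> P %| chebS q -> num_roots_m2_2 R P = degp P.
Proof.
move=> q0 Pq; have P0 : P != 0.
  by apply: contraTneq Pq => ->; rewrite dvd0p monic_neq0 // chebS_monic.
have PR0 : map_poly (ratr : rat -> R) P != 0 by rewrite map_poly_eq0.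
have : map_poly (ratr : rat -> R) P %| map_poly ratr (chebS q) by rewrite dvdp_map.
(* A divisor of a product of distinct factors [X - z] is, up to a constant, a subproduct, selected
   by the mask [m]. So [P] has as many distinct real roots as its degree. *)
rewrite chebS_factor // => /(dvdp_prod_XsubC (F := id))[m].
set rs := mask m _ => PE.
have urs : uniq rs by rewrite mask_uniq // chebS_roots_uniq.
have perm : perm_eq (rootsR (map_poly ratr P)) rs.
  apply: uniq_perm => // [|z]; first exact: uniq_roots.
  by rewrite -(roots_on_rootsR PR0) /= (eqp_root PE) root_prod_XsubC.
have : size (map_poly (ratr : rat -> R) P) = (size rs).+1.
  by rewrite (eqp_size PE) size_prod_XsubC.
rewrite size_map_poly /num_roots_m2_2 /degp (permP perm) => ->.
apply/eqP; rewrite -all_count; apply/allP => z /mem_mask.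
move=> /mem_chebS_roots-/(_ q0)[k _ ->].
have := cos_geN1 (k%:R / q%:R * pi : R).
by have := cos_le1 (k%:R / q%:R * pi : R); lra.
Qed.

Lemma acos_angle (R : realType) (k q : nat) : (0 < k < q)%N ->
  q%:R * acos (2 * cos (k%:R / q%:R * pi) / 2) / pi = k%:R :> R.
Proof.
move=> kq; have /andP[k0 k1] := natr_div_itv R _ _ kq.
have pi0 := pi_gt0 R; have qR : q%:R != 0 :> R by rewrite pnatr_eq0; lia.
have -> (c : R) : 2 * c / 2 = c by field.
rewrite cosK; last by rewrite in_itv /=; apply/andP; split; nra.
move: (lt0r_neq0 pi0); move: pi => c c0.
by field; rewrite qR c0.
Qed.

Lemma exists_candidates (P : {poly rat}) : exists qs, enumerates_candidates P qs.
Proof.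
(* The search bound comes from [q <= totient (2 * q) ^ 2]. *)
exists [seq q <- iota 0 ((2 * degp P) ^ 2).+1 |
  (2 <= q)%N && (totient (2 * q) == 2 * degp P)%N].
split=> [|q]; first by rewrite filter_uniq // iota_uniq.
rewrite mem_filter mem_iota /= add0n andb_idr // => /andP[q2 /eqP <-].
by rewrite ltnS totient_double_lower_bound //; lia.
Qed.

(** The loop cannot get stuck: if [P] divides [S_q], then [x] is a root [2 cos (k pi / q)] of [S_q],
    so the enclosed value is the integer [k], whether or not [k] and [q] are coprime. *)
Lemma candidate_loop_exists (R : realType) (x : R) (P : {poly rat})
    (I : interval rat) (qs : seq nat) : 0 <= x < 2 ->
  minimal_polynomial P x -> isolating P I x -> {in qs, forall q, 0 < q}%N ->
  exists out, candidate_loop R P I qs out.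
Proof.
move=> hx hP hI; elim: qs => [|q qs IH] qs0.
  by exists (0, 0%N); apply: Loop_end.
have q0 : (0 < q)%N by apply: qs0; rewrite mem_head.
have [|out outP] := IH; first by move=> r rq; apply: qs0; rewrite in_cons rq orbT.
have [Pq|Pq] := boolP (P %| chebS q); last by exists out; apply: Loop_next.
have [k kq xE] : exists2 k : nat, (0 < k < q)%N & x = 2 * cos (k%:R / q%:R * pi).
  by apply/is_root_chebS => //; rewrite hP.2.
have [|I' [J [? ? ?]]] := exists_angle_enclosure _ _ _ _ q k%:Z hx hI.
  by rewrite xE acos_angle.
by exists (k%:Z, q); apply: (@Loop_return _ _ _ _ _ I' J).
Qed.

Lemma candidate_loop_out (R : realType) (P : {poly rat}) (I : interval rat)
    (qs : seq nat) (out : int * nat) : candidate_loop R P I qs out ->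
  (out = (0, 0%N) /\ {in qs, forall q, ~~ (P %| chebS q)}) \/
  (exists q I' J p, [/\ out = (p, q), q \in qs, P %| chebS q,
     refines R P I' I & angle_enclosure R q I' J /\ unique_int_in J p]).
Proof.
elim=> {qs out} [|q qs out Pq _ IH|q qs I' J p Pq rI encl uniqp].
- by left.
- case: IH => [[-> IH]|[q' [I' [J [p [? q'qs ? ? ?]]]]]]; [left|right].
    by split=> // r; rewrite in_cons => /predU1P[->|/IH].
  by exists q', I', J, p; split=> //; rewrite in_cons q'qs orbT.
- by right; exists q, I', J, p; split; rewrite ?mem_head.
Qed.

(* The root of P isolated by I' also lies in I, hence it is x. *)
Lemma enclosed_angle (R : realType) (x : R) (P : {poly rat})
    (I I' J : interval rat) (q p' : nat) (p : int) :
  0 <= x < 2 -> isolating P I x -> refines R P I' I ->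
  angle_enclosure R q I' J -> unique_int_in J p ->
  (0 < p' < q)%N -> x = 2 * cos (p'%:R / q%:R * pi) -> p = p'%:Z.
Proof.
move=> hx [_ _ Iuniq] [I'I [y [Py I'y _]]] encl [_ Juniq] pq xE.
have yx : y = x by apply: Iuniq => //; apply: I'I.
move: I'y; rewrite yx => /encl -/(_ _)/wrap[]; first by lra.
rewrite {1}xE acos_angle // => Jp; apply/esym/Juniq; move: Jp.
(* The enclosure is a statement over the reals, uniqueness one over the rationals; [ratr] preserves
   and reflects the order of the bounds. *)
rewrite /in_ratitv; case: J {encl Juniq} => l u; rewrite -[p'%:R]ratr_nat.
by rewrite !itv_boundlr /=; case: l u => [[] l|[]] [[] u|[]] //=;
  rewrite ?bnd_simp ?ler_rat ?ltr_rat.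
Qed.

Theorem theorem3p9 (R : realType) (x : R) (P : {poly rat}) (I : interval rat)
    (opt : bool) (hx : 0 <= x < 2) (hP : minimal_polynomial P x)
    (hI : isolating P I x) :
  (exists out : int * nat, rational_angle_recovery R opt P I out) /\
  (forall out : int * nat, rational_angle_recovery R opt P I out ->
     (forall r : rat, is_angle_of x r ->
        exists p q : nat,
          [/\ out = (p%:Z, q), r = p%:R / q%:R, (2 <= q)%N,
              (1 <= p <= q - 1)%N & coprime p q]) /\
     (~ (exists r : rat, is_angle_of x r) -> out = (0, 0%N))).
Proof.
split.
  have [fail|nofail] := boolP (opt && fails_root_test R P).
    by exists (0, 0%N); apply: Recovery_reject.
  have [qs [uqs qsP]] := exists_candidates P.
  have [|out outP] := candidate_loop_exists _ _ _ I qs hx hP hI.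
    by move=> q; rewrite qsP => /andP[/ltnW].
  by exists out; apply: Recovery_search outP.
move=> out run; split=> [r rx|no_angle].
  have [p [q [rE pq cop xE]]] := is_angle_of_natr_div _ _ _ rx.
  have q0 : (0 < q)%N by lia.
  have [Pq degP] := cos_angle_degree _ _ _ _ _ hP pq cop xE.
  exists p, q; split=> //; try lia.
  (* No run fails: [P] passes the root test because it divides [S_q], and the loop cannot reach its
     end because [q] is among the candidates. *)
  case: run => [|qs out' _ [_ qsP] /candidate_loop_out].
    by rewrite /fails_root_test (num_roots_dvdp_chebS _ _ q) // eqxx andbF.
  case=> [[_ /(_ q)]|[q' [I' [J [p' [-> q'qs Pq' rI [encl uniqp]]]]]]].
    have q2 : (2 <= q)%N by lia.
    by rewrite qsP degP eqxx Pq q2 => /(_ isT).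
  (* The loop might have stopped at another candidate [q']. But [p'' / q'] and [p / q] are reduced
     fractions of the same angle, hence equal termwise. *)
  move: q'qs; rewrite qsP => /andP[q'2 /eqP q'E].
  have q'0 : (0 < q')%N by lia.
  have [p'' [p''q' cop' xE']] := candidate_cos_angle _ _ _ _ hP q'0 Pq' q'E.
  have k2 : (2 : R) != 0 by rewrite pnatr_eq0.
  move: (xE'); rewrite {1}xE => /(mulfI k2)/cos_mul_pi_inj.
  have /andP[? ?] := natr_div_itv R _ _ pq.
  have /andP[? ?] := natr_div_itv R _ _ p''q'; rewrite !ltW // => /(_ isT isT).
  move/eqP; rewrite eqr_div ?pnatr_eq0 -?lt0n // -!natrM eqr_nat => /eqP pp.
  have qq : q' = q.
    apply/eqP; rewrite eqn_dvd -{1}(@Gauss_dvdr _ p'') 1?coprime_sym //.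
    by rewrite -pp dvdn_mull //= -(@Gauss_dvdr _ p) 1?coprime_sym // pp dvdn_mull.
  have pE : p'' = p by apply/eqP; move/eqP: pp; rewrite qq eqn_pmul2r // eq_sym.
  rewrite qq pE in p''q' xE' encl *.
  by rewrite (enclosed_angle _ _ _ _ _ _ _ _ _ hx hI rI encl uniqp p''q' xE').
case: run => [//|qs out' _ [_ qsP] /candidate_loop_out].
case=> [[//]|[q [I' [J [p [_ q_qs Pq _ _]]]]]].
have q0 : (0 < q)%N by move: q_qs; rewrite qsP; lia.
(* A returned pair means that [P] divides [S_q], which makes [x] the double cosine of some
   [k pi / q]. *)
case: no_angle.
have [k kq xE] : exists2 k : nat, (0 < k < q)%N & x = 2 * cos (k%:R / q%:R * pi).
  by apply/is_root_chebS => //; rewrite hP.2.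
have /andP[k0 k1] := natr_div_itv rat _ _ kq.
exists (k%:R / q%:R); rewrite /is_angle_of ratr_natr_div k0; split=> //=.
(* An angle beyond [pi / 2] has a negative cosine, contradicting [0 <= x]. *)
rewrite leNgt; apply/negP => k_half.
have : cos (k%:R / q%:R * pi) < cos (pi / 2) :> R.
  have pi0 := pi_gt0 R; have /andP[? ?] := natr_div_itv R _ _ kq.
  have : (1 / 2 : R) < k%:R / q%:R.
    by rewrite -(ratr_natr_div R k) -(ratr_natr_div R 1 2) ltr_rat.
  by move=> half_lt; rewrite ltr_cos ?in_itv /=; nra.
by rewrite cos_pihalf; lra.
Qed.
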